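(* Let $n\ge 2$ be an integer, let $E=\{e\subseteq [n]: |e|=2\}$ and $m=|E|=\binom n2$. Then the polynomial $$f_3(x)=\sum_{(e_1,e_2,e_3)\in E^3}\ \prod_{i=1}^3\frac{x_{e_i}}{|e_1\cup\cdots\cup e_i|}$$ in the variables $x=(x_e)_{e\in E}$ attains its global minimum over the standard simplex $\Delta_m$ at the barycenter $x^*=\frac1m(1,\ldots,1)$; that is, $f_3(x^* )\le f_3(x)$ for all $x\in\Delta_m$.
   Context: $[n]=\{1,\ldots,n\}$. The standard simplex is $\Delta_m=\{x=(x_e)_{e\in E}\in\mathbb R^m: x_e\ge 0 \text{ for all } e\in E,\ \sum_{e\in E}x_e=1\}$. *)

(* Defs.v *)
From mathcomp Require Import all_boot all_order all_algebra.
From mathcomp Require Import reals.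

Set Implicit Arguments.
Unset Strict Implicit.
Unset Printing Implicit Defensive.

Import Order.TTheory GRing.Theory Num.Theory.
Local Open Scope ring_scope.

(* [n] is modelled by 'I_n, that is, {0, ..., n-1}. *)
Definition edge (n : nat) := {e : {set 'I_n} | #|e| == 2%N}.

Lemma card_edge (n : nat) : #|{: edge n}| = 'C(n, 2).
Proof. by rewrite card_sig -[in RHS](card_ord n) -card_draws cardsE. Qed.

Definition in_simplex (R : realType) (I : finType) (x : {ffun I -> R}) : Prop :=
  (forall i, 0 <= x i) /\ \sum_i x i = 1.

Definition barycenter (R : realType) (I : finType) : {ffun I -> R} :=
  [ffun=> #|I|%:R^-1].

(* A triple of edges is a finite function on 'I_3; since indices start at 0,
   the factor with index i divides by the size of the union of the edges with
   indices 0, ..., i. *)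
Definition f3 (R : realType) (n : nat) (x : {ffun edge n -> R}) : R :=
  \sum_(e : {ffun 'I_3 -> edge n})
    \prod_(i < 3) (x (e i) / #|\bigcup_(j < 3 | (j <= i)%N) val (e j)|%:R).

(* Main.v *)
(* Up to a factor 6, f_3 is the cubic form of the kernel
     K(a, b, c) = (1/|a u b| + 1/|a u c| + 1/|b u c|) / |a u b u c|,
   which is symmetric in its three arguments. For each fixed c the matrix
   K(., ., c) is positive semidefinite, by an explicit sum of squares, and by
   transitivity of the symmetric group on edges the sum of its entries does not
   depend on c. Bounding each quadratic form K(., ., c) below by its tangent at
   the barycenter, once weighted by x and once summed over all c, gives
   f_3(x) >= f_3(x^* ). *)
Require Import Defs.
From mathcomp Require Import all_boot all_order all_algebra.
From mathcomp Require Import reals.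
From mathcomp Require Import fingroup perm.
From mathcomp Require Import zify ring lra.

Set Implicit Arguments.
Unset Strict Implicit.
Unset Printing Implicit Defensive.

Import Order.TTheory GRing.Theory Num.Theory.
Local Open Scope ring_scope.

(** * Positive semidefinite kernels on a finite set and their closure properties *)

Section PositiveSemidefinite.
Variables (R : realFieldType) (I : finType).
Implicit Types (K : I -> I -> R) (v g : I -> R).

Definition psd K := forall v, 0 <= \sum_a \sum_b v a * v b * K a b.

Lemma eq_psd K L : K =2 L -> psd K -> psd L.
Proof.
move=> eqKL psdK v; rewrite (eq_bigr (fun a => \sum_b v a * v b * K a b)) //.
by move=> a _; apply: eq_bigr => b _; rewrite eqKL.
Qed.

Lemma psd_rank1 g : psd (fun a b => g a * g b).
Proof.
move=> v; suff -> : \sum_a \sum_b v a * v b * (g a * g b)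
  = (\sum_a v a * g a) ^+ 2 by rewrite sqr_ge0.
rewrite expr2 big_distrlr; apply: eq_bigr => a _; apply: eq_bigr => b _ /=; ring.
Qed.

Lemma psd_diag (d : I -> R) :
  (forall a, 0 <= d a) -> psd (fun a b => (a == b)%:R * d a).
Proof.
move=> d_ge0 v; apply: sumr_ge0 => a _; rewrite (bigD1 a) //= big1 => [|b neq_ba].
  by rewrite addr0 eqxx mul1r mulr_ge0 // -expr2 sqr_ge0.
by rewrite eq_sym (negbTE neq_ba) mul0r mulr0.
Qed.

Lemma psdD K L : psd K -> psd L -> psd (fun a b => K a b + L a b).
Proof.
move=> psdK psdL v; have := addr_ge0 (psdK v) (psdL v).
rewrite -big_split /=; congr (_ <= _); apply: eq_bigr => a _.
by rewrite -big_split /=; apply: eq_bigr => b _; rewrite mulrDr.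
Qed.

Lemma psdZ (t : R) K : 0 <= t -> psd K -> psd (fun a b => t * K a b).
Proof.
move=> t_ge0 psdK v; have := mulr_ge0 t_ge0 (psdK v).
rewrite mulr_sumr; congr (_ <= _); apply: eq_bigr => a _.
by rewrite mulr_sumr; apply: eq_bigr => b _; rewrite mulrCA.
Qed.

Lemma psd_sum (J : finType) (P : pred J) (K : J -> I -> I -> R) :
  (forall j, P j -> psd (K j)) -> psd (fun a b => \sum_(j | P j) K j a b).
Proof.
move=> psdK v.
suff -> : \sum_a \sum_b v a * v b * (\sum_(j | P j) K j a b)
  = \sum_(j | P j) \sum_a \sum_b v a * v b * K j a b.
  by apply: sumr_ge0 => j /psdK.
rewrite [RHS]exchange_big; apply: eq_bigr => a _.
by rewrite [RHS]exchange_big; apply: eq_bigr => b _; rewrite mulr_sumr.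
Qed.

End PositiveSemidefinite.

(** Writes an intersection size as a sum of rank-one kernels in [A] and [B], one for each point of
    [X]. *)
Lemma sum_mem_mem (R : nzRingType) (T : finType) (X A B : {set T}) :
  \sum_(i in X) (i \in A)%:R * (i \in B)%:R = #|X :&: (A :&: B)|%:R :> R.
Proof.
rewrite -sumr_const (bigID (mem (A :&: B))) /= [X in _ + X]big1 ?addr0.
  apply: eq_big => [i|i /andP[_]]; first by rewrite !inE.
  by rewrite inE => /andP[-> ->]; rewrite mulr1.
move=> i /andP[_]; rewrite inE negb_and.
by case/orP => /negbTE ->; rewrite ?mul0r ?mulr0.
Qed.

(** * The kernel on edges and its decomposition into squares *)

Section Kernel.
Variables (R : realFieldType) (n : nat).
Implicit Types (a b c e : edge n).

Definition size2 a b := #|val a :|: val b|.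
Definition size3 a b c := #|val a :|: val b :|: val c|.

Definition kernel a b c : R :=
  (size3 a b c)%:R^-1 *
  ((size2 a b)%:R^-1 + (size2 a c)%:R^-1 + (size2 b c)%:R^-1).

Lemma cardE a : #|val a| = 2%N.
Proof. exact/eqP/(valP a). Qed.

Definition meet a c : nat := #|val a :&: val c|.
(** Common vertices of [a] and [b] are counted separately inside and outside [c]; with [meet a c]
    and [meet b c], these two counts determine [kernel a b c]. *)
Definition meet_in a b c : nat := #|val c :&: (val a :&: val b)|.
Definition meet_out a b c : nat := #|~: val c :&: (val a :&: val b)|.

Lemma size2E a b : (size2 a b = 4 - meet a b)%N.
Proof. by rewrite /size2 cardsU !cardE. Qed.

Lemma meet_split a b c : (meet a b = meet_in a b c + meet_out a b c)%N.
Proof.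
by rewrite /meet -(cardsID (val c)) setDE /meet_in /meet_out !(setIC (val a :&: _)).
Qed.

Lemma card_meetU a b c :
  (#|(val a :|: val b) :&: val c| + meet_in a b c = meet a c + meet b c)%N.
Proof. by rewrite -[RHS]cardsUI -setIUl -setIIl [in RHS](setIC (_ :&: _) (val c)). Qed.

(** Inclusion-exclusion, where [meet_out a b c] is the pairwise term of [a] and [b] minus the triple
    term. *)
Lemma size3E a b c :
  (size3 a b c = 6 - meet a c - meet b c - meet_out a b c)%N.
Proof.
have := card_meetU a b c; have := cardsUI (val a) (val b).
have := cardsUI (val a :|: val b) (val c).
rewrite -/(size3 a b c) -/(meet a b) (meet_split a b c) !cardE; lia.
Qed.

Lemma meet_bounds a b c :
  [/\ (meet a c + meet_out a b c <= 2)%N, (meet b c + meet_out a b c <= 2)%N,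
      (meet_in a b c <= meet a c)%N, (meet_in a b c <= meet b c)%N &
      (meet a c + meet b c <= 2 + meet_in a b c)%N ].
Proof.
have out d : (meet d c + #|~: val c :&: val d| = 2)%N.
  by have := cardsID (val c) (val d); rewrite setDE (setIC _ (~: _)) cardE.
have outa : (meet_out a b c <= #|~: val c :&: val a|)%N.
  by rewrite subset_leq_card // setIS // subsetIl.
have outb : (meet_out a b c <= #|~: val c :&: val b|)%N.
  by rewrite subset_leq_card // setIS // subsetIr.
split; first by rewrite -(out a) leq_add2l.
- by rewrite -(out b) leq_add2l.
- by rewrite subset_leq_card // setIC setSI // subsetIl.
- by rewrite subset_leq_card // setIC setSI // subsetIr.
rewrite -card_meetU leq_add2r.
by have := subset_leq_card (subsetIr (val a :|: val b) (val c)); rewrite cardE.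
Qed.

(** Makes the diagonal term of [kernel_sos] a function of intersection sizes. *)
Lemma eq_edge_meet a b : (a == b) = (meet a b == 2)%N.
Proof.
apply/eqP/idP => [->|/eqP ab2]; first by rewrite /meet setIid cardE.
have sub (d : edge n) :
    val a :&: val b \subset val d -> val a :&: val b = val d.
  by move=> ?; apply/eqP; rewrite eqEcard cardE -/(meet a b) ab2 andbT.
by apply: val_inj; rewrite -(sub a) ?subsetIl // (sub b) ?subsetIr.
Qed.

Definition ind (r : nat) c a : R := (meet a c == r)%:R.

(* If a and b share no vertex outside c, the entry K(a, b, c) depends only on
   |a n c| and |b n c|, except that for edges meeting c in one vertex each it also
   matters whether that vertex is the same. The first three squares are the 3 x 3
   form with these two cases averaged, after completing squares; the sum over c
   corrects the averaging, and the sums outside c and the diagonal term account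
   for vertices shared outside c. *)
Lemma kernel_sos c a b :
  kernel a b c =
    1 / 8 * ((ind 0 c a + 4 / 3 * ind 1 c a + 2 * ind 2 c a) *
             (ind 0 c b + 4 / 3 * ind 1 c b + 2 * ind 2 c b))
  + 1 / 4 * ((2 / 9 * ind 1 c a + ind 2 c a) *
             (2 / 9 * ind 1 c b + ind 2 c b))
  + 13 / 2592 * (ind 1 c a * ind 1 c b)
  + 1 / 24 * (\sum_(i in ~: val c)
        ((i \in val a)%:R * (ind 0 c a + 3 / 2 * ind 1 c a)) *
        ((i \in val b)%:R * (ind 0 c b + 3 / 2 * ind 1 c b)))
  + 1 / 96 * (\sum_(i in ~: val c)
        ((i \in val a)%:R * ind 1 c a) * ((i \in val b)%:R * ind 1 c b))
  + 1 / 48 * (\sum_(i in val c)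
        (((i \in val a)%:R - 1 / 2) * ind 1 c a) *
        (((i \in val b)%:R - 1 / 2) * ind 1 c b))
  + (a == b)%:R * (1 / 24 * ind 0 c a + 5 / 144 * ind 1 c a).
Proof.
have outE (p q : R) : \sum_(i in ~: val c)
    ((i \in val a)%:R * p) * ((i \in val b)%:R * q)
    = (meet_out a b c)%:R * (p * q).
  rewrite -sum_mem_mem mulr_suml; apply: eq_bigr => i _; ring.
have inE (p q : R) : \sum_(i in val c)
    (((i \in val a)%:R - 1 / 2) * p) * (((i \in val b)%:R - 1 / 2) * q)
    = ((meet_in a b c)%:R - 1 / 2 * (meet a c)%:R - 1 / 2 * (meet b c)%:R + 1 / 2)
      * (p * q).
  have meetE d : (meet d c)%:R = \sum_(i in val c) (i \in val d)%:R :> R.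
    rewrite /meet setIC -[val d in LHS]setIid -sum_mem_mem.
    by apply: eq_bigr => i _; case: (i \in _); rewrite ?mulr1 ?mulr0.
  (* The edge [c] has two vertices, so the constant is spread as 1/4 on each. *)
  have halfE : 1 / 2 = \sum_(i in val c) 1 / 4 :> R.
    by rewrite sumr_const cardE; field.
  rewrite !meetE -sum_mem_mem [X in _ + X]halfE !mulr_sumr -!sumrB -big_split /=.
  rewrite mulr_suml; apply: eq_bigr => i _; by field.
rewrite !outE inE eq_edge_meet /kernel size3E !size2E.
rewrite (meet_split a b c) /ind.
(* Both sides now depend only on four intersection sizes. The bounds leave finitely many values, and
   each case is an identity between rational numbers. *)
have [] := meet_bounds a b c.
move: (meet a c) (meet b c) (meet_in a b c) (meet_out a b c).
case=> [|[|[|ha]]] [|[|[|hb]]] [|[|[|l]]] [|[|[|k]]] //= _ _ _ _ _.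
all: rewrite /subn /=; by field.
Qed.

Lemma psd_kernel c : psd (fun a b => kernel a b c).
Proof.
apply: (eq_psd (fun a b => esym (kernel_sos c a b))).
do ?apply: psdD.
- by apply: psdZ; [lra | apply: psd_rank1].
- by apply: psdZ; [lra | apply: psd_rank1].
- by apply: psdZ; [lra | apply: psd_rank1].
- by apply: psdZ; [lra | apply: psd_sum => i _; apply: psd_rank1].
- by apply: psdZ; [lra | apply: psd_sum => i _; apply: psd_rank1].
- by apply: psdZ; [lra | apply: psd_sum => i _; apply: psd_rank1].
by apply: psd_diag => a; rewrite addr_ge0 // mulr_ge0 ?ler0n //; lra.
Qed.

Lemma kernelC a b c : kernel a b c = kernel b a c.
Proof.
rewrite /kernel /size3 /size2 [val b :|: val a]setUC; congr (_ * _); ring.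
Qed.

Lemma kernelAC a b c : kernel a b c = kernel a c b.
Proof.
rewrite /kernel /size3 /size2 [val c :|: val b]setUC (setUAC _ _ (val b)).
by congr (_ * _); ring.
Qed.

(** * Action of vertex permutations on edges *)

Lemma edge_perm_subproof (s : {perm 'I_n}) a : #|s @: val a| == 2%N.
Proof. by rewrite card_imset ?cardE //; apply: perm_inj. Qed.

Definition edge_perm (s : {perm 'I_n}) a : edge n :=
  exist (fun e : {set 'I_n} => #|e| == 2%N) _ (edge_perm_subproof s a).

Lemma edge_perm_bij s : bijective (edge_perm s).
Proof.
apply: injF_bij => a b /(congr1 val) /= eq_ab; apply: val_inj.
exact: imset_inj (@perm_inj _ s) _ _ eq_ab.
Qed.

Lemma kernel_perm s a b c :
  kernel (edge_perm s a) (edge_perm s b) (edge_perm s c) = kernel a b c.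
Proof.
by rewrite /kernel /size3 /size2 /= -!imsetU !card_imset //; apply: perm_inj.
Qed.

Lemma edge_perm_transitive c c' : exists s, edge_perm s c = c'.
Proof.
have /cards2P[p [q [neq_pq defc]]] : #|val c| == 2%N by rewrite cardE.
have /cards2P[p' [q' [neq_pq' defc']]] : #|val c'| == 2%N by rewrite cardE.
(* The first transposition sends [p] to [p']. The second sends [s q] to [q'] and fixes [p'], which
   differs from [q'] and, by injectivity of [s], from [s q]. *)
pose s := tperm p p'; exists (s * tperm (s q) q')%g.
apply: val_inj; rewrite /= defc defc' imsetU !imset_set1 !permM tpermL tpermL.
rewrite tpermD //; last by rewrite eq_sym.
by rewrite -[p'](tpermL p) (inj_eq perm_inj) eq_sym.
Qed.

Lemma kernel_sum_const c c' :
  \sum_a \sum_b kernel a b c = \sum_a \sum_b kernel a b c'.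
Proof.
have [s <-] := edge_perm_transitive c c'.
have bij_s := onW_bij predT (edge_perm_bij s).
rewrite [RHS](reindex _ bij_s); apply: eq_bigr => a _ /=.
by rewrite [RHS](reindex _ bij_s); apply: eq_bigr => b _ /=; rewrite kernel_perm.
Qed.

End Kernel.

(** * Minimum of a symmetric cubic form with positive semidefinite slices *)

Section CubicMinimum.
Variables (R : realFieldType) (I : finType) (K : I -> I -> I -> R) (S t : R).
Hypothesis KC : forall a b c, K a b c = K b a c.
Hypothesis KAC : forall a b c, K a b c = K a c b.
Hypothesis psdK : forall c, psd (fun a b => K a b c).
Hypothesis sumK : forall c, \sum_a \sum_b K a b c = S.
(** Besides making [t] the barycentric coordinate, this product form forces [I] to be nonempty. *)
Hypothesis tI : t * #|I|%:R = 1.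

Let cubic (x : I -> R) := \sum_c x c * \sum_a \sum_b x a * x b * K a b c.

Let sumr_all (y : R) : t * (\sum_(c : I) y) = y.
Proof. by rewrite sumr_const -mulr_natr mulrCA tI mulr1. Qed.

(** The difference of the two sides is the quadratic form of the slice at [x - t]. *)
Lemma tangent_le_quadratic x c :
  2 * t * (\sum_a \sum_b x a * K a b c) - t ^+ 2 * S
  <= \sum_a \sum_b x a * x b * K a b c.
Proof.
rewrite -subr_ge0; have := psdK c (fun a => x a - t); congr (_ <= _).
have -> : 2 * t * (\sum_a \sum_b x a * K a b c)
  = t * (\sum_a \sum_b x a * K a b c) + t * (\sum_a \sum_b x b * K a b c).
  rewrite [X in _ + _ * X]exchange_big /=.
  under [X in _ + _ * X]eq_bigr do under eq_bigr do rewrite KC.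
  by ring.
rewrite -(sumK c) !mulr_sumr -big_split -!sumrB; apply: eq_bigr => a _ /=.
rewrite !mulr_sumr -big_split -!sumrB; apply: eq_bigr => b _ /=; ring.
Qed.

Lemma cubic_const : cubic (fun=> t) = t ^+ 2 * S.
Proof.
rewrite /cubic (eq_bigr (fun=> t ^+ 3 * S)) => [|c _].
  by rewrite -[RHS]sumr_all mulr_sumr; apply: eq_bigr => c _; ring.
rewrite -(sumK c) !mulr_sumr; apply: eq_bigr => a _.
by rewrite !mulr_sumr; apply: eq_bigr => b _; ring.
Qed.

(* Writing Q for the quadratic forms of x and L for their tangent parts at t, the
   bound 2tL - t^2 S <= Q is used twice, because symmetry of K gives
   sum_c x_c L_c = sum_c Q_c. *)
Lemma cubic_min (x : I -> R) :
  (forall a, 0 <= x a) -> \sum_a x a = 1 -> cubic (fun=> t) <= cubic x.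
Proof.
move=> x_ge0 x_sum1; rewrite cubic_const.
pose L c := \sum_a \sum_b x a * K a b c.
pose Q c := \sum_a \sum_b x a * x b * K a b c.
have le_LQ c : 2 * t * L c - t ^+ 2 * S <= Q c by apply: tangent_le_quadratic.
have t_ge0 : 0 <= t.
  have I_gt0 : 0 < #|I|%:R :> R.
    rewrite lt_neqAle ler0n andbT eq_sym; apply/eqP => I0.
    by move/eqP: tI; rewrite I0 mulr0 eq_sym oner_eq0.
  by rewrite -(pmulr_lge0 _ I_gt0) tI.
have xL : \sum_c x c * L c = \sum_b Q b.
  under eq_bigr do rewrite mulr_sumr; rewrite exchange_big /=.
  under eq_bigr do under eq_bigr do rewrite mulr_sumr.
  under eq_bigr do rewrite exchange_big /=.
  rewrite exchange_big; apply: eq_bigr => b _; apply: eq_bigr => a _.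
  by apply: eq_bigr => c _ /=; rewrite KAC; ring.
(* By symmetry, the terms with [a] fixed add up to [x a] times the sum of slice [a], which is
   [S]. *)
have sumL : \sum_c L c = S.
  rewrite exchange_big -[RHS]mul1r -x_sum1 mulr_suml; apply: eq_bigr => a _ /=.
  rewrite -(sumK a) mulr_sumr exchange_big; apply: eq_bigr => b _ /=.
  by rewrite mulr_sumr; apply: eq_bigr => c _; rewrite KC KAC.
have sumQ : 2 * t * S - t * S <= \sum_c Q c.
  have : \sum_c (2 * t * L c - t ^+ 2 * S) <= \sum_c Q c.
    by apply: ler_sum => c _; apply: le_LQ.
  rewrite sumrB -mulr_sumr sumL; congr (_ - _ <= _).
  by rewrite -[RHS]sumr_all mulr_sumr; apply: eq_bigr => c _; ring.
have : 2 * t * (\sum_c Q c) - t ^+ 2 * S <= cubic x.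
  have -> : S = \sum_c x c * S by rewrite -mulr_suml x_sum1 mul1r.
  rewrite -xL !mulr_sumr -sumrB.
  apply: ler_sum => c _; apply: le_trans (ler_wpM2l (x_ge0 c) (le_LQ c)).
  by rewrite le_eqVlt; apply/orP; left; apply/eqP; ring.
(* The sum of the [Q c] is at least [t * S], so the lower bound for [cubic x] is at least [2 * t *
   (t * S) - t ^+ 2 * S = t ^+ 2 * S]. *)
apply: le_trans; have := ler_wpM2l t_ge0 sumQ; rewrite expr2; lra.
Qed.

End CubicMinimum.

(** * Passage from [f3] to the cubic form of the kernel *)

Lemma sum_ffun3 (R : nmodType) (I : finType) (F : I -> I -> I -> R) :
  \sum_(e : {ffun 'I_3 -> I}) F (e 0) (e 1) (e 2%:R)
  = \sum_a \sum_b \sum_c F a b c.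
Proof.
under [RHS]eq_bigr do rewrite pair_big; rewrite pair_big /=.
pose h (e : {ffun 'I_3 -> I}) := (e 0, (e 1, e 2%:R)).
(* The default [p.1] of [nth] is never reached, since [i < 3]. *)
pose g (p : I * (I * I)) : {ffun 'I_3 -> I} :=
  [ffun i : 'I_3 => nth p.1 [:: p.1; p.2.1; p.2.2] i].
have hK : cancel h g.
  move=> e; apply/ffunP => i; rewrite ffunE /=.
  by case: i => [[|[|[|i]]] lti] //=; congr (e _); apply: val_inj.
have gK : cancel g h by move=> [a [b c]]; rewrite /h !ffunE.
by rewrite [RHS](reindex h) //; apply: onW_bij; exists g.
Qed.

(** In 6 = 2 * 3, the 2 cancels the size of the first edge, and the 3 comes from adding three
    relabellings of the sum, one for each choice of the edge placed last; these give the three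
    summands of [kernel]. *)
Lemma f3_kernel (R : realType) (n : nat) (x : {ffun edge n -> R}) :
  6 * f3 x = \sum_c x c * \sum_a \sum_b x a * x b * kernel R a b c.
Proof.
pose G a b c := x a * x b * x c / ((size2 a b)%:R * (size3 a b c)%:R).
have f3E : 2 * f3 x = \sum_a \sum_b \sum_c G a b c.
  rewrite -sum_ffun3 mulr_sumr; apply: eq_bigr => e _.
  rewrite !big_ord_recl big_ord0 !(big_mkcond (fun j : 'I_3 => (j <= _)%N)).
  rewrite !big_ord_recl !big_ord0 /= !setU0.
  rewrite (_ : lift ord0 ord0 = 1); last exact: val_inj.
  rewrite (_ : lift ord0 (lift ord0 ord0) = 2%:R); last exact: val_inj.
  rewrite (_ : ord0 = 0) // cardE setUA -/(size2 _ _) -/(size3 _ _ _) /G invfM.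
  by move: (_ _ _)%:R^-1 (_ _ _ _)%:R^-1 => p q; field.
pose H a b c := x a * x b * x c / (size3 a b c)%:R.
have GE a b c : G a b c = H a b c * (size2 a b)%:R^-1.
  by rewrite /G /H invfM; ring.
have -> : 6 * f3 x = \sum_a \sum_b \sum_c G a b c + \sum_a \sum_b \sum_c G a c b
   + \sum_a \sum_b \sum_c G b c a.
  have -> : \sum_a \sum_b \sum_c G a c b = \sum_a \sum_b \sum_c G a b c.
    by apply: eq_bigr => a _; rewrite exchange_big.
  have -> : \sum_a \sum_b \sum_c G b c a = \sum_a \sum_b \sum_c G a b c.
    by rewrite exchange_big; apply: eq_bigr => b _; rewrite exchange_big.
  by rewrite -f3E; ring.
under [RHS]eq_bigr do (rewrite mulr_sumr; under eq_bigr do rewrite mulr_sumr).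
rewrite [RHS]exchange_big -!big_split; apply: eq_bigr => a _ /=.
rewrite [RHS]exchange_big -!big_split; apply: eq_bigr => b _ /=.
rewrite -!big_split; apply: eq_bigr => c _ /=.
have size3AC : size3 a c b = size3 a b c by rewrite /size3 setUAC.
have size3CA : size3 b c a = size3 a b c.
  by rewrite /size3 setUC setUA.
rewrite !GE /H /kernel size3AC size3CA; ring.
Qed.

Theorem theorem2 (R : realType) (n : nat) (hn : (2 <= n)%N) :
  in_simplex (barycenter R (edge n)) /\
  forall x : {ffun edge n -> R},
    in_simplex x -> f3 (barycenter R (edge n)) <= f3 x.
Proof.
have edge_neq0 : #|{: edge n}|%:R != 0 :> R.
  by rewrite card_edge pnatr_eq0 -lt0n bin_gt0.
split; first split=> [e|]; first by rewrite ffunE invr_ge0.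
  under eq_bigr do rewrite ffunE.
  by rewrite sumr_const -[LHS]mulr_natr mulVf.
move=> x [x_ge0 x_sum1]; rewrite -(ler_pM2l (_ : 0 < 6)) ?ltr0n // !f3_kernel.
(* Any edge will do: it serves to name the common value of the slice sums. *)
have [c0 _] : exists c0 : edge n, true.
  have : (0 < #|{: edge n}|)%N by rewrite card_edge bin_gt0.
  by case/card_gt0P => c0 _; exists c0.
under eq_bigr do (rewrite ffunE; under eq_bigr do under eq_bigr do rewrite !ffunE).
apply: (cubic_min (S := \sum_a \sum_b kernel R a b c0)) => //.
- exact: kernelC.
- exact: kernelAC.
- exact: psd_kernel.
- by move=> c; apply: kernel_sum_const.
- by rewrite mulVf.
Qed.
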